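(* Let $q$ be a prime power and $m\ge 2$ an even integer. Let $a,b,c\in\mathbb{F}_q$ be such that the quadratic polynomial $ax^2+cx+b$ (with $a\ne0$) is irreducible over $\mathbb{F}_q$, and let $f\in B_m^q$ be the function $$f(x)=x_1x_2+x_3x_4+\ldots+x_{m-3}x_{m-2}+ax_{m-1}^2+bx_m^2+cx_{m-1}x_m .$$ Then $d(f,R_q(1,m))=\rho(1,m)$.
   Context: Let $\mathbb{F}_q$ be the field with $q$ elements. $B_m^q=\mathbb{F}_q[X_1,\ldots,X_m]/(X_1^q-X_1,\ldots,X_m^q-X_m)$ is identified with the set of all functions $\mathbb{F}_q^m\to\mathbb{F}_q$. The degree $\deg(P)$ of $P\in B_m^q$ is the degree of its unique polynomial representative of degree at most $q-1$ in each variable. The weight of $P\in B_m^q$ is $|P|=\mathrm{Card}\{x\in\mathbb{F}_q^m : P(x)\neq 0\}$. The first order generalized Reed-Muller code is $R_q(1,m)=\{P\in B_m^q : \deg(P)\leq 1\}$. For $f\in B_m^q$, $d(f,R_q(1,m))=\min_{c\in R_q(1,m)}|f-c|$, and the covering radius of $R_q(1,m)$ is $\rho(1,m)=\max_{f\in B_m^q} d(f,R_q(1,m))$. For $m=2$ the sum of products $x_1x_2+\ldots+x_{m-3}x_{m-2}$ is empty. *)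

(* Defs.v *)
From HB Require Import structures.
From mathcomp Require Import all_boot all_order all_algebra all_field.
From mathcomp Require Import mpoly.

Set Implicit Arguments.
Unset Strict Implicit.
Unset Printing Implicit Defensive.

Import Order.TTheory GRing.Theory.
Local Open Scope ring_scope.

(* B_m^q, with q = #|F|, as the ring of functions F^m -> F.  Points of F^m are
   m-tuples, so the i-th coordinate x_i (i >= 1) is x`_(i - 1). *)
Notation "''B[' F ]_ m" := {ffun m.-tuple F -> F}
  (at level 8, m at level 2, format "''B[' F ]_ m") : type_scope.

Section ReducedPolynomials.
Variables (F : finFieldType) (m : nat).
Implicit Types (p : {mpoly F[m]}) (f : 'B[F]_m).

Definition reduced p :=
  all (fun mon : 'X_{1..m} => [forall i : 'I_m, mon i <= #|F|.-1]%N) (msupp p).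

Definition represents f p := [forall x : m.-tuple F, p.@[tnth x] == f x].

(* Reduced polynomials are parametrized by their coefficients. *)
Definition red_mnm (phi : {ffun 'I_m -> 'I_#|F|}) : 'X_{1..m} :=
  [multinom (phi i : nat) | i < m].

Definition red_poly (c : {ffun {ffun 'I_m -> 'I_#|F|} -> F}) : {mpoly F[m]} :=
  \sum_phi c phi *: 'X_[red_mnm phi].

Definition red_fun c : 'B[F]_m := [ffun x : m.-tuple F => (red_poly c).@[tnth x]].

Lemma card_pos : (0 < #|F|)%N.
Proof. by apply/card_gt0P; exists 0. Qed.

Lemma reduced_red_poly c : reduced (red_poly c).
Proof.
apply/allP => mon; rewrite mcoeff_msupp /red_poly raddf_sum /= => nz.
apply/forallP => i; apply: contraR nz => big; apply/eqP/big1 => phi _.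
rewrite mcoeffZ mcoeffX; case: eqP => [e|_]; last by rewrite mulr0.
by case/negP: big; rewrite -e mnmE -ltnS prednK ?card_pos // ltn_ord.
Qed.

Lemma red_polyP p : reduced p ->
  p = red_poly [ffun phi => p@_(red_mnm phi)].
Proof.
move=> /allP rp; apply/mpolyP => mon; rewrite /red_poly raddf_sum /=.
under eq_bigr do rewrite mcoeffZ mcoeffX ffunE.
have inj : injective red_mnm.
  move=> phi psi e; apply/ffunP => i; apply: val_inj.
  by move/mnmP/(_ i): e; rewrite !mnmE.
case: (boolP (mon \in msupp p)) => [/rp/forallP le|nin].
  have lt i : (mon i < #|F|)%N by rewrite -(prednK card_pos) ltnS.
  pose phi := [ffun i => Ordinal (lt i)].
  have e : red_mnm phi = mon by apply/mnmP => i; rewrite mnmE ffunE.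
  rewrite (bigD1 phi) //= e eqxx mulr1 big1 ?addr0 // => psi ne.
  by rewrite -e (inj_eq inj) (negbTE ne) mulr0.
rewrite (memN_msupp_eq0 nin) big1 // => phi _.
by case: eqP => [->|_]; rewrite ?mulr0 // (memN_msupp_eq0 nin) mul0r.
Qed.

Definition delta_poly (a : F) : {poly F} := 1 - ('X - a%:P) ^+ #|F|.-1.

Lemma size_delta_poly a : (size (delta_poly a) <= #|F|)%N.
Proof.
rewrite (leq_trans (size_polyD _ _)) // geq_max size_poly1 card_pos /=.
by rewrite size_polyN size_exp_XsubC prednK ?card_pos.
Qed.

Lemma delta_polyE a x : (delta_poly a).[x] = (x == a)%:R.
Proof.
rewrite /delta_poly !hornerE /= -subr_eq0.
have q1 : (0 < #|F|.-1)%N by rewrite -ltnS prednK ?card_pos ?finNzRing_gt1.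
have [->|nz] := eqVneq (x - a) 0; first by rewrite expr0n eqn0Ngt q1 subr0.
suff -> : (x - a) ^+ #|F|.-1 = 1 by rewrite subrr.
by apply: (mulfI nz); rewrite -exprS prednK ?card_pos // expf_card mulr1.
Qed.

Lemma delta_coefE (a x : m.-tuple F) :
  \sum_(phi : {ffun 'I_m -> 'I_#|F|})
     (\prod_(i < m) (delta_poly (tnth a i))`_(phi i)) *
     \prod_(i < m) tnth x i ^+ red_mnm phi i = (x == a)%:R.
Proof.
transitivity (\prod_(i < m) (delta_poly (tnth a i)).[tnth x i]).
  under [RHS]eq_bigr do rewrite (horner_coef_wide _ (size_delta_poly _)).
  rewrite bigA_distr_bigA; apply: eq_bigr => phi _ /=.
  by rewrite -big_split; apply: eq_bigr => i _; rewrite mnmE.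
have [->|ne] := eqVneq x a.
  by rewrite big1 // => i _; rewrite delta_polyE eqxx.
have [i nei] : exists i, tnth x i != tnth a i.
  apply/existsP; apply: contraR ne; rewrite negb_exists => /forallP eqs.
  by apply/eqP/eq_from_tnth => i; move: (eqs i); rewrite negbK => /eqP.
by rewrite (bigD1 i) //= delta_polyE (negbTE nei) mul0r.
Qed.

Lemma red_fun_surj f : exists c, red_fun c = f.
Proof.
exists [ffun phi : {ffun 'I_m -> 'I_#|F|} => \sum_(a : m.-tuple F)
          f a * \prod_(i < m) (delta_poly (tnth a i))`_(phi i)].
apply/ffunP => x; rewrite ffunE /red_poly raddf_sum /=.
under eq_bigr do rewrite mevalZ mevalX ffunE mulr_suml.
rewrite exchange_big /=.
under eq_bigr => a _.
  under eq_bigr do rewrite -mulrA.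
  rewrite -mulr_sumr delta_coefE; over.
rewrite (bigD1 x) //= eqxx mulr1 big1 ?addr0 // => a ne.
by rewrite eq_sym (negbTE ne) mulr0.
Qed.

Lemma red_fun_inj : injective red_fun.
Proof.
have : #|codom red_fun| = #|{ffun {ffun 'I_m -> 'I_#|F|} -> F}|.
  rewrite (eq_card (B := predT)) => [|f]; last first.
    by apply/idP; have [c <-] := red_fun_surj f; apply: codom_f.
  by rewrite -[LHS]/#|'B[F]_m| !card_ffun !card_ord card_tuple.
by move/eqP/image_injP=> inj c d; apply: inj.
Qed.

Lemma exists_reduced f : exists p, reduced p && represents f p.
Proof.
have [c <-] := red_fun_surj f; exists (red_poly c).
by rewrite reduced_red_poly; apply/forallP => x; rewrite ffunE.
Qed.

Lemma reduced_unique f p p' :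
  reduced p -> represents f p -> reduced p' -> represents f p' -> p = p'.
Proof.
move=> rp /forallP fp rp' /forallP fp'.
rewrite (red_polyP rp) (red_polyP rp'); congr red_poly; apply: red_fun_inj.
apply/ffunP => x; rewrite !ffunE -!red_polyP //.
by rewrite (eqP (fp x)) (eqP (fp' x)).
Qed.

Definition red_repr f : {mpoly F[m]} := xchoose (exists_reduced f).

Lemma red_reprP f : reduced (red_repr f) /\ represents f (red_repr f).
Proof. exact/andP/(xchooseP (exists_reduced f)). Qed.

(* msize p is the degree of p plus one; the zero function gets degree 0. *)
Definition deg f : nat := (msize (red_repr f)).-1.

End ReducedPolynomials.

Section Codes.
Variables (F : finFieldType) (m : nat).

Definition weight (f : 'B[F]_m) : nat := #|[set x | f x != 0]|.

Definition GRM (r : nat) : {set 'B[F]_m} := [set f | deg f <= r]%N.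

(* The neutral element #|F| ^ m bounds every weight, so this is the minimum
   whenever C is nonempty. *)
Definition dist (f : 'B[F]_m) (C : {set 'B[F]_m}) : nat :=
  \big[minn/(#|F| ^ m)%N]_(c in C) weight (f - c).

Definition covering_radius (C : {set 'B[F]_m}) : nat :=
  \max_(f : 'B[F]_m) dist f C.

End Codes.

Arguments GRM : clear implicits.

(* Main.v *)
Require Import Defs.
From mathcomp Require Import all_boot all_order all_algebra all_field.
From mathcomp Require Import mpoly.
From mathcomp Require Import ring zify.

Import GRing.Theory.
Local Open Scope ring_scope.

Set Implicit Arguments.
Unset Strict Implicit.
Unset Printing Implicit Defensive.

(** Write q = #|F| and m = 2n + 2.  The distance from h to the affine functions
is q^m minus the largest number of points at which h agrees with an affine
function, and both sides of the theorem equal q^m - (q^(2n+1) + q^n).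

Every h agrees somewhere with an affine function at q^(2n+1) + q^n points or
more ([exists_large_agreement]).  For a linear part u, let N(u, l) be the
number of points where h = u + l.  Counting pairs of points gives the sum of
N(u, l)^2 over all u and l exactly ([second_moment]), since two distinct points
x, y satisfy h x - h y = u (x - y) for a fraction 1/q of all u.  For fixed u the
q numbers N(u, l) have mean D = q^(2n+1), and if none exceeds D + s, their
variance is at most (q - 1) s^2 ([one_sided_variance]).  Comparing the two,
s < q^n is impossible.

The quadratic form of the theorem agrees with no affine function at more than
q^(2n+1) + q^n points ([elliptic_quadric_bound]).  By irreducibility its last
two variables carry an anisotropic form, so for n = 0 the agreement set is a
conic without points at infinity, which has at most q + 1 points
([card_conic]).  Each further product of two variables replaces a count N on a
space Z by (q - 1) #|Z| + q N' ([sum_hyperbolic]), where N' is the count for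
another constant; this preserves the bound.  No square is completed inside the
anisotropic plane, so the argument is the same in every characteristic. *)

(** * Affine functions and the first order code *)

Definition affine (F : finFieldType) (m : nat) (u : {ffun 'I_m -> F}) (l : F)
  : 'B[F]_m := [ffun x : m.-tuple F => \sum_(i < m) u i * tnth x i + l].

Definition agreement (F : finFieldType) (m : nat) (f g : 'B[F]_m) : nat :=
  #|[set x | f x == g x]|.

Lemma weight_agreement (F : finFieldType) (m : nat) (f g : 'B[F]_m) :
  (weight (f - g)%R + agreement f g = #|F| ^ m)%N.
Proof.
rewrite addnC -card_tuple -(cardC (mem [set x | f x == g x])) /weight; congr addn.
by apply: eq_card => x; rewrite !inE !ffunE subr_eq0.
Qed.

(** The obvious polynomial is reduced because its exponents are at most
1 <= q - 1, so by uniqueness it is the one that defines the degree. *)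
Lemma affine_GRM1 (F : finFieldType) (m : nat) (u : {ffun 'I_m -> F}) (l : F) :
  affine u l \in GRM F m 1.
Proof.
set p : {mpoly F[m]} := \sum_(i < m) u i *: 'X_i + l%:MP.
have sz : (msize p <= 2)%N.
  apply: leq_trans (msizeD_le _ _) _; rewrite geq_max.
  apply/andP; split.
    apply: leq_trans (msize_sum _ _ _) _; apply/bigmax_leqP => i _.
    by apply: leq_trans (msizeZ_le _ _) _; rewrite msizeX mdeg1.
  by rewrite msizeC; case: eqP.
have rp : reduced p.
  apply/allP => mon /msize_mdeg_lt lt; apply/forallP => i.
  have le1 : (mdeg mon <= 1)%N by rewrite -ltnS (leq_trans lt sz).
  have q1 : (0 < #|F|.-1)%N by rewrite -ltnS prednK ?card_pos ?finNzRing_gt1.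
  apply: leq_trans q1; apply: leq_trans le1.
  by rewrite mdegE (bigD1 i) //= leq_addr.
have fp : represents (affine u l) p.
  apply/forallP => x; rewrite ffunE mevalD mevalC raddf_sum /=.
  by under eq_bigr do rewrite mevalZ mevalXU.
have [rr fr] := red_reprP (affine u l).
by rewrite inE /deg (reduced_unique rr fr rp fp); case: (msize p) sz => // -[|[]].
Qed.

Lemma GRM1_affine (F : finFieldType) (m : nat) (g : 'B[F]_m) :
  g \in GRM F m 1 -> exists u l, g = affine u l.
Proof.
rewrite inE /deg; set p := red_repr g => sz.
have {}sz : (msize p <= 2)%N by case: (msize p) sz.
have /forallP gp : represents g p by have [] := red_reprP g.
exists [ffun i => p@_U_(i)], p@_0; apply/ffunP => x.
rewrite -(eqP (gp x)) ffunE.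
suff {1}-> : p = \sum_(i < m) p@_U_(i) *: 'X_i + (p@_0)%:MP.
  rewrite mevalD mevalC raddf_sum /=; congr (_ + _).
  by apply: eq_bigr => i _; rewrite mevalZ mevalXU ffunE.
apply/mpolyP => mon; rewrite mcoeffD mcoeffC raddf_sum /=.
under eq_bigr do rewrite mcoeffZ mcoeffX.
have [lt|] := ltnP (mdeg mon) 2; last first.
  move=> le; rewrite memN_msupp_eq0; last first.
    by apply: msize_mdeg_ge; apply: leq_trans sz le.
  rewrite big1 => [|i _].
    by case: eqP => [e|]; rewrite ?mulr0 ?addr0 //; rewrite e mdeg0 in le.
  by case: eqP => [e|]; rewrite ?mulr0 //; rewrite -e mdeg1 in le.
have U0 (i : 'I_m) : (U_(i)%MM == 0%MM) = false by rewrite -mdeg_eq0 mdeg1.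
have [/eqP/mdeg1P[i /eqP->]|ne] := altP (mdeg mon =P 1%N).
  rewrite (bigD1 i) //= eqxx mulr1 big1 => [|j ne].
    by rewrite U0 mulr0 !addr0.
  by rewrite eq_mnm1 (negbTE ne) mulr0.
have : mdeg mon == 0%N by case: (mdeg mon) lt ne => [|[]].
rewrite mdeg_eq0 => /eqP->; rewrite eqxx mulr1 big1 ?add0r // => i _.
by rewrite U0 mulr0.
Qed.

(** * Second moment of the agreement *)

Lemma card_sum_eq (T : finType) (P : pred T) :
  #|[set x | P x]| = (\sum_x P x)%N.
Proof. by rewrite -sum1dep_card big_mkcond; apply: eq_bigr => x _; case: (P x). Qed.

(** Used from right to left, it turns a count of solutions of an equation that
determines its unknown into a double sum. *)
Lemma sum_eq1 (T : finType) (y : T) : (\sum_(x : T) (y == x) = 1)%N.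
Proof. by rewrite (bigD1 y) //= eqxx big1 // => x; rewrite eq_sym => /negbTE->. Qed.

Lemma sum_sq_fibres (F X : finType) (g : X -> F) :
  (\sum_l (\sum_x (g x == l)) ^ 2 = \sum_x \sum_y (g x == g y))%N.
Proof.
transitivity (\sum_l \sum_x \sum_y (g x == l) * (g y == l))%N.
  by apply: eq_bigr => l _; rewrite -mulnn big_distrlr.
rewrite exchange_big; apply: eq_bigr => x _ /=.
rewrite exchange_big; apply: eq_bigr => y _ /=.
rewrite (bigD1 (g x)) //= eqxx mul1n big1 ?addn0 1?eq_sym // => l ne.
by rewrite eq_sym (negbTE ne).
Qed.

(** Adding to u a multiple of the i-th basis vector shifts the value at z
arbitrarily, so the fibres over all s have the same cardinality. *)
Lemma card_hyperplane (F : finFieldType) (m : nat) (z : m.-tuple F) (s : F) i :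
  tnth z i != 0 ->
  (#|F| * \sum_(u : {ffun 'I_m -> F}) ((\sum_(j < m) u j * tnth z j)%R == s)
   = #|F| ^ m)%N.
Proof.
move=> nz; pose dot (u : {ffun 'I_m -> F}) := \sum_(j < m) u j * tnth z j.
pose e t : {ffun 'I_m -> F} := [ffun j => if j == i then t / tnth z i else 0].
have dote t u : dot (u + e t) = dot u + t.
  rewrite /dot; under eq_bigr do rewrite !ffunE mulrDl.
  rewrite big_split /=; congr (_ + _).
  rewrite (bigD1 i) //= eqxx divfK // big1 ?addr0 // => j /negbTE->.
  by rewrite mul0r.
have same t : (\sum_u (dot u == t) = \sum_u (dot u == s))%N.
  rewrite (reindex_inj (addIr (e (t - s)))); apply: eq_bigr => u _.
  by rewrite dote -(inj_eq (addIr (t - s)) (dot u) s) [s + _]addrC subrK.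
transitivity (\sum_t \sum_u (dot u == t))%N.
  by under [RHS]eq_bigr do rewrite same; rewrite sum_nat_const.
rewrite exchange_big /=; under eq_bigr do rewrite sum_eq1.
by rewrite sum1_card card_ffun card_ord.
Qed.

(** The sum counts triples (u, x, y) with h x - h y = u (x - y): every u for
x = y, and a hyperplane of them for x <> y. *)
Lemma second_moment (F : finFieldType) (m : nat) (h : 'B[F]_m.+1) :
  (\sum_u \sum_l agreement h (affine u l) ^ 2
   = #|F| ^ m.+1 * (#|F| ^ m.+1 + (#|F| ^ m.+1 - 1) * #|F| ^ m))%N.
Proof.
pose dot (u : {ffun 'I_m.+1 -> F}) (x : m.+1.-tuple F) := \sum_j u j * tnth x j.
transitivity (\sum_u \sum_x \sum_y ((h x - dot u x)%R == (h y - dot u y)%R))%N.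
  apply: eq_bigr => u _; rewrite -sum_sq_fibres; apply: eq_bigr => l _.
  congr (_ ^ 2)%N; rewrite /agreement card_sum_eq; apply: eq_bigr => x _.
  by rewrite ffunE subr_eq addrC.
rewrite exchange_big -[X in _ = (X * _)%N]card_tuple -sum_nat_const.
apply: eq_bigr => x _; rewrite exchange_big (bigD1 x) //=; congr addn.
  under eq_bigr do rewrite eqxx.
  by rewrite sum1_card card_ffun card_ord.
rewrite -[X in (_ = (X - _) * _)%N]card_tuple subn1 -(cardC1 x) -sum_nat_const.
apply: eq_big => // y ne.
have [i nei] : exists i, tnth x i != tnth y i.
  apply/existsP; apply: contraR ne; rewrite negb_exists => /forallP eqs.
  by apply/eqP/eq_from_tnth => i; move: (eqs i); rewrite negbK eq_sym => /eqP.
pose z : m.+1.-tuple F := [tuple tnth x i - tnth y i | i < m.+1].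
have nz : tnth z i != 0 by rewrite tnth_mktuple subr_eq0.
have /eqP := @card_hyperplane F m.+1 z (h x - h y) i nz.
rewrite expnS eqn_pmul2l ?card_pos // => /eqP <-.
apply: eq_bigr => u _; congr nat_of_bool.
have -> : \sum_j u j * tnth z j = dot u x - dot u y.
  by rewrite /dot -sumrB; apply: eq_bigr => j _; rewrite tnth_mktuple mulrBr.
rewrite eq_sym -subr_eq0 -[RHS]subr_eq0.
by congr (_ == 0); ring.
Qed.

(** * A lower bound on the best agreement *)

Lemma sum_sq_le_sq_sum (I : finType) (e : I -> nat) :
  (\sum_i e i ^ 2 <= (\sum_i e i) ^ 2)%N.
Proof.
rewrite -mulnn big_distrlr; apply: leq_sum => i _ /=.
by rewrite (bigD1 i) //= mulnn leq_addr.
Qed.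

(** The deficits D + s - N i are nonnegative with sum #|I| * s, so the sum of
their squares is at most (#|I| * s)^2; the extreme case has a single nonzero
deficit. *)
Lemma one_sided_variance (I : finType) (N : I -> nat) (D s : nat) :
  (forall i, N i <= D + s)%N -> (\sum_i N i = #|I| * D)%N ->
  (\sum_i N i ^ 2 <= #|I| * D ^ 2 + #|I| * (#|I| - 1) * s ^ 2)%N.
Proof.
move=> leN sumN; pose e i := (D + s - N i)%N.
have sume : (\sum_i e i = #|I| * s)%N.
  have : (\sum_i (N i + e i) = #|I| * (D + s))%N.
    by rewrite -sum_nat_const; apply: eq_bigr => i _; rewrite subnKC.
  by rewrite big_split /= sumN mulnDr => /addnI.
have sq : (\sum_i N i ^ 2 + 2 * (D + s) * \sum_i e i
           = #|I| * (D + s) ^ 2 + \sum_i e i ^ 2)%N.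
  rewrite big_distrr -big_split -sum_nat_const -big_split.
  by apply: eq_bigr => i _ /=; have := leN i; rewrite /e; nia.
have := sum_sq_le_sq_sum e; move: sq; rewrite sume; nia.
Qed.

Lemma exists_large_agreement (F : finFieldType) (n : nat) (h : 'B[F]_n.*2.+2) :
  exists u l, (#|F| ^ n.*2.+1 + #|F| ^ n <= agreement h (affine u l))%N.
Proof.
set q := #|F|; set D := (q ^ n.*2.+1)%N.
have q1 : (1 < q)%N by apply: finNzRing_gt1.
have [/existsP[u /existsP[l ?]]|] :=
    boolP [exists u, exists l, D + q ^ n <= agreement h (affine u l)]%N.
  by exists u, l.
rewrite negb_exists => /forallP small; exfalso.
have [s rE] : exists s, (q ^ n = s.+1)%N.
  by exists (q ^ n).-1; rewrite prednK // expn_gt0 card_pos.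
have var u : (\sum_l agreement h (affine u l) ^ 2
              <= q * D ^ 2 + q * (q - 1) * s ^ 2)%N.
  apply: one_sided_variance => [l|].
    have := small u; rewrite negb_exists => /forallP/(_ l).
    by rewrite -ltnNge rE addnS ltnS.
  under eq_bigr do rewrite /agreement card_sum_eq.
  rewrite exchange_big /= -expnS -card_tuple -sum1_card; apply: eq_bigr => x _.
  rewrite -(sum_eq1 (h x - \sum_i u i * tnth x i)); apply: eq_bigr => l _.
  by rewrite ffunE subr_eq [l + _]addrC.
have := leq_sum (index_enum _) (fun u (_ : predT u) => var u).
rewrite second_moment sum_nat_const card_ffun card_ord leq_pmul2l; last first.
  by rewrite expn_gt0 card_pos.
(* D = q (s + 1)^2, whereas the two estimates give D <= q s^2. *)
have DE : D = (q * s.+1 ^ 2)%N by rewrite -rE -expnM muln2 -expnS.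
have D0 : (0 < D)%N by rewrite expn_gt0 card_pos.
rewrite expnS -/D -/q mulnBl mul1n => le.
have : ((q - 1) * D <= (q - 1) * (q * s ^ 2))%N.
  have leD : (D <= q * D * D)%N by rewrite leq_pmull // muln_gt0 D0 (ltnW q1).
  move: q D s q1 le leD {rE DE D0 var small} => [|k] // D s _.
  by rewrite subn1 -!mulnn /=; lia.
rewrite leq_pmul2l ?subn_gt0 // DE leq_pmul2l ?(ltnW q1) //.
by rewrite leqNgt ltn_sqr ltnS leqnn.
Qed.

(** * Points on elliptic quadrics *)

(** Through a point p0 of the conic pass q + 1 lines.  As the quadratic part
does not vanish on directions, each line meets the conic in at most one further
point, which the function [second] gives explicitly; on the tangent line that
point is p0 itself.  So [second] reaches every point of the conic. *)
Lemma card_conic (F : finFieldType) (a b c u v t : F) :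
  (forall x y, a * x ^+ 2 + b * y ^+ 2 + c * x * y = 0 -> x = 0 /\ y = 0) ->
  (#|[set p : F * F | (a * p.1 ^+ 2 + b * p.2 ^+ 2 + c * p.1 * p.2
                       + u * p.1 + v * p.2)%R == t]| <= #|F|.+1)%N.
Proof.
move=> aniso; set Z := [set p | _].
have [->|[[x0 y0]]] := set_0Vmem Z; first by rewrite cards0.
rewrite inE /= => /eqP Z0.
pose Q (d : F * F) := a * d.1 ^+ 2 + b * d.2 ^+ 2 + c * d.1 * d.2.
pose L1 := 2%:R * a * x0 + c * y0 + u; pose L2 := 2%:R * b * y0 + c * x0 + v.
pose L (d : F * F) := L1 * d.1 + L2 * d.2.
(* The q + 1 directions, represented by slopes, with None for the vertical. *)
pose dir (o : option F) := if o is Some k then (1, k) else (0, 1) : F * F.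
pose second o := let d := dir o in
  (x0 - L d / Q d * d.1, y0 - L d / Q d * d.2).
have on_line (d : F * F) s : (x0 + s * d.1, y0 + s * d.2) \in Z ->
    s * (s * Q d + L d) = 0.
  by rewrite inE /= => /eqP Zs; rewrite -[RHS](subrr t) -{1}Zs -Z0 /Q /L /L1 /L2; ring.
have Qdir o : Q (dir o) != 0.
  apply/eqP => /aniso []; case: o => [k|] /= e1 e2.
    by move/eqP: e1; rewrite oner_eq0.
  by move/eqP: e2; rewrite oner_eq0.
have hit o s : s != 0 -> (x0 + s * (dir o).1, y0 + s * (dir o).2) \in Z ->
    (x0 + s * (dir o).1, y0 + s * (dir o).2) = second o.
  move=> s0 /on_line/eqP; rewrite mulf_eq0 (negbTE s0) addr_eq0 /= => /eqP e.
  rewrite /second; have -> : s = - (L (dir o) / Q (dir o)).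
    by rewrite -mulNr -e mulfK.
  by rewrite !mulNr.
have [tangent Lt] : exists o, L (dir o) = 0.
  have [L20|L2n0] := eqVneq L2 0; first by exists None; rewrite /L /= L20; ring.
  by exists (Some (- L1 / L2)); rewrite /L /=; field.
rewrite -card_option; apply: leq_trans (leq_imset_card second predT).
apply: subset_leq_card; apply/subsetP => -[x y] xyZ.
have [xe|xn] := eqVneq x x0; last first.
  have s0 : x - x0 != 0 by rewrite subr_eq0.
  have e : (x, y) = (x0 + (x - x0) * (dir (Some ((y - y0) / (x - x0)))).1,
                     y0 + (x - x0) * (dir (Some ((y - y0) / (x - x0)))).2).
    by congr pair => /=; field.
  by rewrite e (hit _ _ s0) -?e // imset_f.
have [ye|yn] := eqVneq y y0; last first.
  have s0 : y - y0 != 0 by rewrite subr_eq0.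
  have e : (x, y) = (x0 + (y - y0) * (dir None).1, y0 + (y - y0) * (dir None).2).
    by congr pair => /=; rewrite ?xe; ring.
  by rewrite e (hit _ _ s0) -?e // imset_f.
apply/imsetP; exists tangent => //.
by rewrite /second Lt xe ye !mul0r !subr0.
Qed.

(** If x <> - v, then y is determined by x and z, whatever z is.  If x = - v,
then y cancels out and the equation becomes g z = t + u v. *)
Lemma sum_hyperbolic (F : finFieldType) (Z : finType) (g : Z -> F) (u v t : F) :
  (\sum_(x : F) \sum_(y : F) \sum_z
       ((x * y + g z + u * x + v * y)%R == t)
   = (#|F| - 1) * #|Z| + #|F| * \sum_z (g z == (t + u * v)%R))%N.
Proof.
rewrite (bigD1 (- v)) //= addnC; congr addn.
  rewrite subn1 -(cardC1 (- v)) -sum_nat_const; apply: eq_bigr => x nx.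
  rewrite exchange_big /= -sum1_card; apply: eq_bigr => z _.
  have xv : x + v != 0 by rewrite addr_eq0.
  rewrite -(sum_eq1 ((t - g z - u * x) / (x + v))); apply: eq_bigr => y _.
  congr nat_of_bool; rewrite -[RHS](inj_eq (mulIf xv)) divfK //.
  by rewrite -subr_eq0 -[RHS]subr_eq0 -[RHS]oppr_eq0; congr (_ == 0); ring.
rewrite -sum_nat_const; apply: eq_bigr => y _; apply: eq_bigr => z _.
by rewrite -subr_eq0 -[in RHS]subr_eq0; congr (nat_of_bool (_ == 0)); ring.
Qed.

Lemma sum_tuple_cons (F : finType) (n : nat) (P : n.+1.-tuple F -> nat) :
  (\sum_x P x = \sum_a \sum_(z : n.-tuple F) P [tuple of a :: z])%N.
Proof.
rewrite pair_big /= (reindex (fun p : F * n.-tuple F => [tuple of p.1 :: p.2])) //.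
exists (fun x => (thead x, [tuple of behead x])) => [[x z] _|x _] /=.
  by congr pair; apply: val_inj.
by rewrite [RHS]tuple_eta; apply: val_inj.
Qed.

(** The induction splits off the first two coordinates, so the anisotropic plane
stays in the last two.  It runs over all linear parts u and all constants t,
because each split changes both. *)
Lemma elliptic_quadric_bound (F : finFieldType) (a b c : F) (n : nat)
    (u : nat -> F) (t : F) :
  (forall x y, a * x ^+ 2 + b * y ^+ 2 + c * x * y = 0 -> x = 0 /\ y = 0) ->
  (#|[set x : n.*2.+2.-tuple F |
       (\sum_(j < n) x`_(j.*2) * x`_(j.*2.+1)
       + (a * x`_n.*2 ^+ 2 + b * x`_n.*2.+1 ^+ 2 + c * x`_n.*2 * x`_n.*2.+1)
       + \sum_(i < n.*2.+2) u i * x`_i)%R == t]|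
   <= #|F| ^ n.*2.+1 + #|F| ^ n)%N.
Proof.
move=> aniso; elim: n u t => [|n IH] u t.
  rewrite expn1 expn0 addn1; apply: leq_trans (card_conic (u 0%N) (u 1%N) t aniso).
  rewrite !card_sum_eq sum_tuple_cons -(pair_bigA _ (fun x y => nat_of_bool
    ((a * x ^+ 2 + b * y ^+ 2 + c * x * y + u 0%N * x + u 1%N * y)%R == t))) /=.
  apply: leq_sum => x _; rewrite sum_tuple_cons; apply: leq_sum => y _.
  rewrite (big_pred1 [tuple]) => [|z]; last first.
    by rewrite /= eq_sym; apply/esym/eqP/val_inj/esym/size0nil/size_tuple.
  by rewrite big_ord0 !big_ord_recl big_ord0 /= add0r addr0 addrA.
pose g (z : n.*2.+2.-tuple F) := \sum_(j < n) z`_(j.*2) * z`_(j.*2.+1)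
  + (a * z`_n.*2 ^+ 2 + b * z`_n.*2.+1 ^+ 2 + c * z`_n.*2 * z`_n.*2.+1)
  + \sum_(i < n.*2.+2) u i.+2 * z`_i.
rewrite card_sum_eq sum_tuple_cons.
under eq_bigr do rewrite sum_tuple_cons.
(* In each summand, the terms in the first two coordinates are separated. *)
under eq_bigr => x _ do under eq_bigr => y _ do under eq_bigr => z _ do
  (rewrite big_ord_recl [\sum_(i < n.+1.*2.+2) _]big_ord_recl big_ord_recl /=;
   set lhs := (_ + _);
   (have -> : lhs = x * y + g z + u 0%N * x + u 1%N * y by
     rewrite /lhs /g /bump /=; ring)).
rewrite sum_hyperbolic card_tuple -card_sum_eq.
have := IH (fun i => u i.+2) (t + u 0%N * u 1%N).
rewrite -/(#|[set z | g z == _]|); move: #|_| => k /(leq_mul (leqnn #|F|)) le.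
rewrite doubleS mulnBl mul1n -expnS.
have le2 : (#|F| ^ n.*2.+2 <= #|F| ^ n.*2.+3)%N.
  by rewrite leq_exp2l ?finNzRing_gt1.
by rewrite -[X in (_ <= X + _)%N](subnK le2) -addnA leq_add2l !expnS -mulnDr -expnS.
Qed.

(** A nontrivial zero (x, y) has y <> 0, and then x / y would be a root of an
irreducible polynomial of degree two. *)
Lemma irreducible_anisotropic (F : fieldType) (a b c : F) : a != 0 ->
  irreducible_poly (a *: 'X^2 + c *: 'X + b%:P) ->
  forall x y, a * x ^+ 2 + b * y ^+ 2 + c * x * y = 0 -> x = 0 /\ y = 0.
Proof.
move=> a0 irr x y e; have [y0|y0] := eqVneq y 0.
  move/eqP: e; rewrite y0 expr0n !mulr0 !addr0 mulf_eq0 (negbTE a0) expf_eq0.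
  by move=> /eqP.
have sz : size (a *: 'X^2 + c *: 'X + b%:P) = 3.
  rewrite -addrA size_polyDl size_scale ?size_polyXn //.
  rewrite (leq_ltn_trans (size_polyD _ _)) // gtn_max.
  rewrite (leq_ltn_trans (size_scale_leq _ _)) ?size_polyX //=.
  by rewrite (leq_ltn_trans (size_polyC_leq1 _)).
have [_ /(_ ('X - (x / y)%:P))] := irr.
rewrite size_XsubC dvdp_XsubCl => /(_ isT) rt.
have /rt/eqp_size : root (a *: 'X^2 + c *: 'X + b%:P) (x / y).
  rewrite /root !hornerD !hornerZ hornerXn hornerX hornerC; apply/eqP.
  transitivity ((a * x ^+ 2 + b * y ^+ 2 + c * x * y) / y ^+ 2); first by field.
  by rewrite e mul0r.
by rewrite size_XsubC sz.
Qed.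

(** * Distance and covering radius *)

Lemma dist_le (F : finFieldType) (m : nat) (f g : 'B[F]_m) (C : {set 'B[F]_m}) :
  g \in C -> (dist f C <= weight (f - g)%R)%N.
Proof.
rewrite /dist => gC; have : g \in index_enum _ := mem_index_enum g.
elim: (index_enum _) => // h r IH; rewrite inE big_cons => /predU1P[<-|/IH le].
  by rewrite gC geq_minl.
by case: ifP => // _; apply: leq_trans (geq_minr _ _) le.
Qed.

Lemma le_dist (F : finFieldType) (m B : nat) (f : 'B[F]_m) (C : {set 'B[F]_m}) :
  (B <= #|F| ^ m)%N -> (forall g, g \in C -> B <= weight (f - g)%R)%N ->
  (B <= dist f C)%N.
Proof.
move=> leB leC; rewrite /dist; elim/big_rec: _ => // g d gC led.
by rewrite leq_min leC.
Qed.

Theorem mainTheorem5 (F : finFieldType) (m : nat) (a b c : F)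
    (m_ge2 : (2 <= m)%N) (m_even : ~~ odd m)
    (a_neq0 : a != 0)
    (irr : irreducible_poly (a *: 'X^2 + c *: 'X + b%:P))
    (f : 'B[F]_m)
    (fE : forall x : m.-tuple F,
       f x = \sum_(j < (m - 2)./2) x`_(j.*2) * x`_(j.*2.+1)
             + a * x`_(m - 2) ^+ 2 + b * x`_(m - 1) ^+ 2
             + c * x`_(m - 2) * x`_(m - 1)) :
  dist f (GRM F m 1) = covering_radius (GRM F m 1).
Proof.
have [n mE] : exists n, m = n.*2.+2.
  exists (m - 2)./2; move: m_ge2 m_even; case: m {f fE irr} => [|[|k]] //= _.
  by rewrite negbK subn2 /= => ek; rewrite halfK (negbTE ek) subn0.
subst m; apply/eqP; rewrite eqn_leq /covering_radius.
rewrite (leq_bigmax (F := fun h => dist h _)) /=.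
pose T := (#|F| ^ n.*2.+1 + #|F| ^ n)%N.
apply: (@leq_trans (#|F| ^ n.*2.+2 - T)%N).
  apply/bigmax_leqP => h _; have [u [l le]] := exists_large_agreement h.
  apply: leq_trans (dist_le h (affine_GRM1 u l)) _.
  by rewrite -(weight_agreement h (affine u l)) -addnBA ?leq_addr.
apply: le_dist (leq_subr _ _) _ => g /GRM1_affine[u [l ->]].
rewrite -(weight_agreement f (affine u l)) leq_subLR addnC leq_add2r.
apply: leq_trans (elliptic_quadric_bound n (fun i => - u (inord i)) l
                    (irreducible_anisotropic a_neq0 irr)).
apply/eq_leq/eq_card => x; rewrite !inE fE ffunE subn2 subn1 /= doubleK.
rewrite -subr_eq0 -[RHS]subr_eq0; congr (_ == 0).
have -> : \sum_(i < n.*2.+2) - u (inord i) * x`_i = - \sum_i u i * tnth x i.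
  by rewrite -sumrN; apply: eq_bigr => i _; rewrite inord_val mulNr (tnth_nth 0).
ring.
Qed.
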